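(* Let $G$ be a group, let $Q:=\operatorname{Conj}G$ be its conjugation quandle, let $U_Q$ be the set of GL-structures on $Q$, and for $\mathtt{u}_1,\mathtt{u}_2\in U_Q$ write $\mathtt{u}_1\sim\mathtt{u}_2$ if and only if $(Q,\mathtt{u}_1)\cong(Q,\mathtt{u}_2)$ as GL-racks. If $G$ is abelian, then $U_Q=S_G$ (the group of all permutations of the set $G$), and $U_Q/{\sim}$ is the set of conjugacy classes of $S_G$. If $G$ is centerless (that is, has trivial center), then $U_Q=\{\operatorname{id}_G\}$.
   Context: For a set $X$, $S_X$ is the group of permutations of $X$; products of maps denote composition. A rack is a pair $(X,s)$ of a set $X$ and a map $s:X\to S_X$, $x\mapsto s_x$, such that $s_xs_y=s_{s_x(y)}s_x$ for all $x,y\in X$; it is a quandle if also $s_x(x)=x$ for all $x$. For a group $G$, $\operatorname{Conj}G$ is the quandle with underlying set $G$ and $s_x(y)=xyx^{-1}$. A rack homomorphism $(X,s)\to(Y,t)$ is a map $\varphi:X\to Y$ with $\varphi s_x=t_{\varphi(x)}\varphi$ for all $x\in X$, and $\operatorname{Aut}R$ is the group of rack automorphisms of $R$. A GL-structure on $R=(X,s)$ is an automorphism $\mathtt{u}\in\operatorname{Aut}R$ such that $\mathtt{u}s_x=s_x\mathtt{u}$ for all $x\in X$; the pair $(R,\mathtt{u})$ is called a GL-rack. A GL-rack homomorphism $(R_1,\mathtt{u}_1)\to(R_2,\mathtt{u}_2)$ is a rack homomorphism $\varphi$ with $\varphi\mathtt{u}_1=\mathtt{u}_2\varphi$; isomorphisms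 are bijective homomorphisms. *)

(* Defs.v *)
From HB Require Import structures.
From mathcomp Require Import all_boot.
From mathcomp Require Import boolp classical_sets.

Set Implicit Arguments.
Unset Strict Implicit.
Unset Printing Implicit Defensive.

Local Open Scope classical_set_scope.
Local Open Scope group_scope.

(* fingroup's [{perm T}] requires a finite [T]; here [X] is arbitrary. *)
Record Perm (X : Type) := MkPerm {
  perm_fun :> X -> X;
  perm_bij : bijective perm_fun
}.

Section PermGroup.
Variable X : Type.
Implicit Types u v w : Perm X.

Lemma perm_ext u v : (u : X -> X) =1 v -> u = v.
Proof.
case: u v => [f fb] [g gb] /= /funext fg; rewrite fg in fb *.
by congr MkPerm; exact: Prop_irrelevance.
Qed.

Definition perm_one : Perm X := MkPerm (Bijective (frefl (@id X)) (frefl (@id X))).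

Definition perm_mul u v : Perm X := MkPerm (bij_comp (perm_bij u) (perm_bij v)).

Lemma perm_inv_ex u : exists v, cancel u v /\ cancel v u.
Proof.
case: u => f [g fK gK] /=.
by exists (MkPerm (Bijective gK fK)).
Qed.

Definition perm_inv u : Perm X := projT1 (cid (perm_inv_ex u)).

Lemma perm_invK u : cancel u (perm_inv u).
Proof. by rewrite /perm_inv; case: cid => v []. Qed.

Lemma perm_invVK u : cancel (perm_inv u) u.
Proof. by rewrite /perm_inv; case: cid => v []. Qed.

Lemma perm_mulA : associative perm_mul.
Proof. by move=> u v w; exact: perm_ext. Qed.

Lemma perm_mul1 : left_id perm_one perm_mul.
Proof. by move=> u; exact: perm_ext. Qed.

Lemma perm_mulr1 : right_id perm_one perm_mul.
Proof. by move=> u; exact: perm_ext. Qed.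

Lemma perm_mulV : left_inverse perm_one perm_inv perm_mul.
Proof. by move=> u; apply: perm_ext => x /=; rewrite perm_invK. Qed.

Lemma perm_mulrV : right_inverse perm_one perm_inv perm_mul.
Proof. by move=> u; apply: perm_ext => x /=; rewrite perm_invVK. Qed.

HB.instance Definition _ := gen_eqMixin (Perm X).
HB.instance Definition _ := gen_choiceMixin (Perm X).
HB.instance Definition _ := isGroup.Build (Perm X)
  perm_mulA perm_mul1 perm_mulr1 perm_mulV perm_mulrV.

End PermGroup.

Record rack := Rack {
  rack_sort :> Type;
  rack_op : rack_sort -> Perm rack_sort;
  rackP : forall x y : rack_sort,
    rack_op x * rack_op y = rack_op (rack_op x y) * rack_op x
}.

Record quandle := Quandle {
  quandle_rack :> rack;
  quandleP : forall x : quandle_rack, rack_op x x = x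
}.

Definition rack_hom (R1 R2 : rack) (phi : R1 -> R2) : Prop :=
  forall x : R1, phi \o rack_op x = rack_op (phi x) \o phi.

Definition rack_Aut (R : rack) : set (Perm R) := [set u : Perm R | rack_hom u].
Arguments rack_Aut R : clear implicits.

Section ConjugationQuandle.
Variable G : groupType.

Lemma conj_bij (x : G) : bijective (fun y : G => x * y * x^-1).
Proof.
by exists (fun y : G => x^-1 * y * x) => y; rewrite !mulgA ?mulVg ?mulgV mul1g
  -mulgA ?mulVg ?mulgV mulg1.
Qed.

Definition conj_perm (x : G) : Perm G := MkPerm (conj_bij x).

Lemma conj_rackP (x y : G) :
  conj_perm x * conj_perm y = conj_perm (conj_perm x y) * conj_perm x.
Proof.
apply: perm_ext => z /=.
by rewrite !invgM !invgK !mulgA !mulgVK.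
Qed.

Definition Conj_rack : rack := Rack conj_rackP.

Lemma conj_quandleP (x : Conj_rack) : rack_op x x = x.
Proof. exact: mulgK. Qed.

Definition Conj : quandle := Quandle conj_quandleP.

End ConjugationQuandle.

Definition GL_structures (R : rack) : set (Perm R) :=
  [set u : Perm R | rack_Aut R u /\ forall x : R, u * rack_op x = rack_op x * u].
Arguments GL_structures R : clear implicits.

Record GL_rack := GLRack {
  GL_base :> rack;
  GL_u : Perm GL_base;
  GL_uP : GL_structures GL_base GL_u
}.

Definition GL_hom (R1 R2 : GL_rack) (phi : R1 -> R2) : Prop :=
  rack_hom phi /\ phi \o GL_u R1 = GL_u R2 \o phi.

Definition GL_isomorphic (R1 R2 : GL_rack) : Prop :=
  exists phi : R1 -> R2, GL_hom phi /\ bijective phi.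

Definition GL_equiv (R : rack) (u1 u2 : Perm R) : Prop :=
  exists (h1 : GL_structures R u1) (h2 : GL_structures R u2),
    GL_isomorphic (GLRack h1) (GLRack h2).

(* [A / r] as a set of subsets of [T], for [r] an equivalence relation on [A]. *)
Definition quotient_set (T : Type) (A : set T) (r : T -> T -> Prop) :
    set (set T) :=
  [set [set v | A v /\ r u v] | u in A].

Definition is_abelian (G : groupType) : Prop := forall x y : G, commute x y.
Arguments is_abelian G : clear implicits.

Definition center (G : groupType) : set G :=
  [set z | forall x : G, commute z x].
Arguments center G : clear implicits.

Definition centerless (G : groupType) : Prop := center G = [set 1].
Arguments centerless G : clear implicits.

Definition conjugacy_class (G : groupType) (x : G) : set G :=
  [set x ^ g | g in [set: G]].

Definition conjugacy_classes (G : groupType) : set (set G) :=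
  [set conjugacy_class x | x in [set: G]].
Arguments conjugacy_classes G : clear implicits.

(* Main.v *)
Require Import Defs.
From mathcomp Require Import all_boot.
From mathcomp Require Import boolp classical_sets.
Local Open Scope classical_set_scope.
Local Open Scope group_scope.

(** If [u] is a GL-structure then [s_x u = u s_x = s_(u x) u], so [s_x = s_(u x)]
    for all [x].  In [Conj G] this says that [(u x)^-1 * x] is central, which
    forces [u = 1] when [G] is centerless.  When [G] is abelian every [s_x] is
    the identity, so every permutation is a GL-structure and a GL-rack
    isomorphism is just a permutation intertwining the two structures. *)

Lemma GL_structure_op (R : rack) (u : Perm R) :
  GL_structures R u -> forall x : R, rack_op (u x) = rack_op x.
Proof.
move=> [uhom ucomm] x; apply/esym/(mulIg u).
rewrite -ucomm; apply: perm_ext => y.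
exact: (congr1 (fun f => f y) (uhom x)).
Qed.

Lemma GL_structure1 (R : rack) : GL_structures R (1 : Perm R).
Proof. by split=> [x //|x]; rewrite mul1g mulg1. Qed.

Lemma Conj_op_inj_center (G : groupType) (x y : Conj G) :
  rack_op x = rack_op y -> center G ((x : G)^-1 * y).
Proof.
move=> exy z; have /= e := congr1 (fun p : Perm G => p z) exy.
(* Expanding [y * z] to [(y * z * y^-1) * y] lets [e] replace the bracket by [x * z * x^-1], whose
   leading [x] cancels. *)
by rewrite /commute -mulgA -(mulgVK y (y * z)) -e !mulgA mulVg mul1g.
Qed.

Lemma Conj_abelian_op (G : groupType) :
  is_abelian G -> forall x : Conj G, rack_op x = 1.
Proof. by move=> Gab x; apply: perm_ext => y /=; rewrite (Gab x y) mulgK. Qed.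

Lemma trivial_GL_structures (R : rack) :
  (forall x : R, rack_op x = 1) -> GL_structures R = [set: Perm R].
Proof.
move=> R1; rewrite -subTset => u _; split=> [x|x]; rewrite !R1 //.
by rewrite mulg1 mul1g.
Qed.

Lemma trivial_GL_equivP (R : rack) (u v : Perm R) :
  (forall x : R, rack_op x = 1) ->
  GL_equiv u v <-> exists g : Perm R, v = u ^ g.
Proof.
move=> R1; split=> [[h1 [h2 [phi [[_ uv] phib]]]]|[g ->]].
  pose p : Perm R := MkPerm phib.
  (* Intertwining says [p * u = v * p], so [v = p * u * p^-1]; as [u ^ g] is [g^-1 * u * g], the
     conjugator is [p^-1]. *)
  exists p^-1; rewrite conjgE invgK mulgA; apply: (canRL (mulgK _)).
  by apply: perm_ext => x; exact: (esym (congr1 (fun f => f x) uv)).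
have GLT w : GL_structures R w by rewrite trivial_GL_structures.
(* For the same reason the isomorphism from [u] to [u ^ g] is [g^-1]. *)
exists (GLT u), (GLT (u ^ g)), (g^-1 : Perm R); split; last exact: perm_bij.
split=> [x|/=]; first by rewrite /= !R1.
have e : g^-1 * u = u ^ g * g^-1 by rewrite conjgE -!mulgA mulgV mulg1.
exact: (congr1 (fun p : Perm R => p : R -> R) e).
Qed.

Theorem proposition4p7 (G : groupType) :
  (is_abelian G ->
     GL_structures (Conj G) = [set: Perm G] /\
     quotient_set (GL_structures (Conj G)) (@GL_equiv (Conj G)) =
       conjugacy_classes (Perm G)) /\
  (centerless G -> GL_structures (Conj G) = [set (1 : Perm G)]).
Proof.
split=> [/Conj_abelian_op s1|Z1].
  have GLT := trivial_GL_structures _ s1; split=> //.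
  (* Both sides become images of the full set of permutations, so it suffices to compare the two
     classes of each [u]. *)
  rewrite /quotient_set /conjugacy_classes GLT; congr image.
  apply: funext => u; apply/seteqP; split=> v /=.
    by move=> [_ /(trivial_GL_equivP _ _ _ s1)[g ->]]; exists g.
  by move=> [g _ <-]; split=> //; apply/trivial_GL_equivP => //; exists g.
apply/seteqP; split=> [u uGL|_ ->]; last exact: (GL_structure1 (Conj G)).
apply: perm_ext => x /=.
have := Conj_op_inj_center _ _ _ (GL_structure_op _ _ uGL x).
by rewrite Z1 /= => /(canRL (mulVKg _)); rewrite mulg1.
Qed.
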